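(* Let $d\ge 2$ be an integer. The $d$-dimensional Pólya random walk $(\mathbf{X}_n)_{n\ge 0}$ is transient, i.e. every state of the walk is transient.
   Context: Pólya–Eggenberger urn: an urn initially contains $w>0$ white balls and $b>0$ blue balls ($w,b$ integers). At each unit of discrete time a ball is drawn uniformly at random from the urn and is returned to the urn together with one additional ball of the same color. Let $W_n$ and $B_n$ be the numbers of white and blue draws among the first $n$ draws. One-dimensional Pólya random walk: a particle starts at the origin, $X_0=0$, and after each draw moves by $+1$ if the drawn ball is white and by $-1$ if it is blue, so $X_n=W_n-B_n\in\mathbb{Z}$. $d$-dimensional Pólya random walk: take $d$ independent one-dimensional Pólya random walks $X_n^{(1)},\ldots,X_n^{(d)}$, the $i$th being driven by its own Pólya–Eggenberger urn (with its own initial numbers $w_i\ge1$ of white and $b_i\ge 1$ of blue balls), and set $\mathbf{X}_n=(X_n^{(1)},\ldots,X_n^{(d)})$. Thus all coordinates change by $\pm1$ at each step. The states of the walk are the points of $\mathbb{Z}^d$ that it can reach from the origin with positive probability. Recurrence: a state is recurrent if the particle's probability of returning to it infinitely often is $1$; a state that is not recurrent is transient. The walk is transient if all its states are transient. *)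

(* Defs.v *)
From mathcomp Require Import all_boot all_order all_algebra.
From mathcomp Require Import all_classical all_reals all_analysis.

Set Implicit Arguments.
Unset Strict Implicit.
Unset Printing Implicit Defensive.

Import Order.TTheory GRing.Theory Num.Theory.

Local Open Scope classical_set_scope.
Local Open Scope ring_scope.

(* The outcome of a draw is a boolean: [true] is white, [false] is blue;
   [D k] is the outcome of draw number k + 1. *)

Section Urn.
Context {disp : measure_display} {T : measurableType disp} {R : realType}.
Variable P : probability T R.

Definition history (D : nat -> T -> bool) (s : seq bool) : set T :=
  [set t | forall k, (k < size s)%N -> D k t = nth false s k].

(* Number of balls of colour [c] in the urn after the draws recorded in [s]. *)
Definition balls (w b : nat) (s : seq bool) (c : bool) : nat :=
  ((if c then w else b) + count_mem c s)%N.

(* Given the past draws, the next ball is uniform among the balls in the urn: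
   P(next colour is c | history s) is the proportion of balls of colour c.
   The conditional probability is written as a product. *)
Definition polya_urn (w b : nat) (D : nat -> {RV P >-> bool}) : Prop :=
  forall (s : seq bool) (c : bool),
    P (history D (rcons s c)) =
    (P (history D s) *
     ((balls w b s c)%:R / (balls w b s true + balls w b s false)%:R)%:E)%E.

Definition white_draws (D : nat -> T -> bool) (n : nat) (t : T) : nat :=
  (\sum_(k < n) D k t)%N.

Definition blue_draws (D : nat -> T -> bool) (n : nat) (t : T) : nat :=
  (\sum_(k < n) ~~ D k t)%N.

Definition walk1 (D : nat -> T -> bool) (n : nat) (t : T) : int :=
  (white_draws D n t)%:Z - (blue_draws D n t)%:Z.

(* The sigma-algebra generated by an integer-valued process; [int] carries the
   discrete sigma-algebra, hence the arbitrary set [B]. *)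
Definition process_sigma (X : nat -> T -> int) : set (set T) :=
  <<s [set A | exists n (B : set int), A = X n @^-1` B] >>.

Definition independent_processes (d : nat) (X : 'I_d -> nat -> T -> int) :
    Prop :=
  forall (J : {set 'I_d}) (A : 'I_d -> set T),
    (forall i, i \in J -> process_sigma (X i) (A i)) ->
    P (\bigcap_(i in [set i | i \in J]) A i) = (\prod_(i in J) P (A i))%E.

Definition walk (d : nat) (D : 'I_d -> nat -> T -> bool) (n : nat) (t : T) :
    'rV[int]_d :=
  \row_i walk1 (D i) n t.

Section Recurrence.
Variables (S : Type) (X : nat -> T -> S).

Definition is_state (x : S) : Prop :=
  exists n, (0 < P [set t | X n t = x])%E.

(* The limit superior of the events X_n = x is the event that x is visited
   infinitely often. *)
Definition recurrent_state (x : S) : Prop :=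
  P (lim_sup_set (fun n => [set t | X n t = x])) = 1%E.

Definition transient_state (x : S) : Prop := ~ recurrent_state x.

Definition transient_process : Prop :=
  forall x, is_state x -> transient_state x.

End Recurrence.

End Urn.

(* Main.v *)
Require Import Defs.
From mathcomp Require Import all_boot all_order all_algebra.
From mathcomp Require Import all_classical all_reals all_analysis.
From mathcomp Require Import zify ring lra.

(** Writing [W n] for the number of white draws of one urn, the point is that
no value of [W n] is taken with probability greater than
[(w + b - 1) / (n + w + b - 1)].  Indeed [W n.+1 = k] happens either from
[W n = k] by a blue draw, with probability [(b + n - k) / (w + b + n)], or from
[W n = k - 1] by a white draw, with probability [(w + k - 1) / (w + b + n)].
For [1 <= k <= n] the two weights add up to [(w + b + n - 1) / (w + b + n)];
for [k = 0] and [k = n + 1] a single weight remains, and it is no larger because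
[w] and [b] are positive.  Hence the largest point mass of [W n],
multiplied by [n + w + b - 1], cannot increase with [n] ([white_draws_bound]).

Since the position of the one-dimensional walk determines [W n], each
coordinate of the walk is at a given point at time [n] with probability
[O(1 / n)].  Two independent coordinates are therefore simultaneously at
prescribed points with probability [O(1 / n ^ 2)], which is summable
([nneseries_inv_sqr_lty]), and the Borel-Cantelli lemma shows that each point
is almost surely visited only finitely often: the probability of infinitely
many visits is [0]. *)

Set Implicit Arguments.
Unset Strict Implicit.
Unset Printing Implicit Defensive.

Import Order.TTheory GRing.Theory Num.Theory.

Local Open Scope classical_set_scope.
Local Open Scope ring_scope.

(** * Draws, histories and positions *)

Section Colours.
Context {disp : measure_display} {T : measurableType disp}.
Variable D : nat -> T -> bool.

Lemma white_drawsS n t : white_draws D n.+1 t = (white_draws D n t + D n t)%N.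
Proof. by rewrite /white_draws big_ord_recr. Qed.

Lemma white_draws_le n t : (white_draws D n t <= n)%N.
Proof.
elim: n => [|n IHn]; first by rewrite /white_draws big_ord0.
by rewrite white_drawsS -addn1 leq_add// leq_b1.
Qed.

Lemma blue_drawsE n t : blue_draws D n t = (n - white_draws D n t)%N.
Proof.
elim: n => [|n IHn]; first by rewrite /blue_draws big_ord0.
rewrite /blue_draws big_ord_recr/= -/(blue_draws D n t) IHn white_drawsS.
by have := white_draws_le n t; case: (D n t) => /=; lia.
Qed.

Lemma history_rcons s c :
  history D (rcons s c) = history D s `&` [set t | D (size s) t = c].
Proof.
apply/seteqP; split => t /=.
- move=> h; split; last by rewrite h ?size_rcons// nth_rcons ltnn eqxx.
  by move=> k ks; rewrite h ?size_rcons 1?ltnW// nth_rcons ks.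
- move=> [h hc] k; rewrite size_rcons ltnS leq_eqVlt nth_rcons.
  by case/predU1P => [->|ks]; rewrite ?ltnn ?eqxx// ks h.
Qed.

Lemma white_draws_history s t :
  history D s t -> white_draws D (size s) t = count_mem true s.
Proof.
elim/last_ind: s => [_|s c IHs]; first by rewrite /white_draws big_ord0.
rewrite history_rcons size_rcons white_drawsS => -[/IHs -> /= ->].
by rewrite -cats1 count_cat/= addn0; case: c.
Qed.

Lemma history_inj n (s s' : n.-tuple bool) t :
  history D s t -> history D s' t -> s = s'.
Proof.
move=> hs hs'; apply/val_inj/(@eq_from_nth _ false); rewrite ?size_tuple//.
by move=> k kn; rewrite -hs ?size_tuple// hs' ?size_tuple.
Qed.

Lemma history_mkseq n t : history D (mkseq (D ^~ t) n) t.
Proof. by move=> k; rewrite size_mkseq => kn; rewrite nth_mkseq. Qed.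

(** The urn scheme prescribes the probabilities of colour histories only, so
every event about the number of white draws is cut into the finitely many
histories of length [n] that produce it. *)
Lemma white_draws_bigcup n k :
  [set t | white_draws D n t = k] =
  \bigcup_(s in [set s : n.-tuple bool | count_mem true s = k]) history D s.
Proof.
apply/seteqP; split => t /=.
- move=> <-; exists [tuple of mkseq (D ^~ t) n]; last exact: (@history_mkseq n t).
  by rewrite /= -(white_draws_history (@history_mkseq n t)) size_mkseq.
- by move=> [s /= <- hs]; rewrite -(white_draws_history hs) size_tuple.
Qed.

(** At time [n] the position is [2 W - n], where [W] is the number of white
draws, so it determines [W].  Positions that are out of reach have an empty
fiber, hence the inclusion in place of an explicit value of [W]. *)
Lemma walk1_fiber n (z : int) :
  exists k, [set t | walk1 D n t = z] `<=` [set t | white_draws D n t = k].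
Proof.
have [[t0 h0]|no] := pselect (exists t, walk1 D n t = z); last first.
  by exists 0%N => t /= ht; exfalso; apply: no; exists t.
exists (white_draws D n t0) => t /= ht.
have := white_draws_le n t; have := white_draws_le n t0.
by move: ht h0; rewrite /walk1 !blue_drawsE; lia.
Qed.

End Colours.

(** * Point masses of the number of white draws *)

Section OneUrn.
Context {disp : measure_display} {T : measurableType disp} {R : realType}.
Variables (P : probability T R) (D : nat -> {RV P >-> bool}).

Lemma measurable_draw k c : measurable [set t | D k t = c].
Proof. exact: (@measurable_funPTI _ _ _ _ (D k) [set c]). Qed.

Lemma measurable_history s : measurable (history D s).
Proof.
elim/last_ind: s => [|s c IHs].
  by rewrite (_ : history _ _ = setT)//; apply/seteqP; split.
by rewrite history_rcons; apply: measurableI => //; exact: measurable_draw.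
Qed.

Lemma measurable_white_draws n k : measurable [set t | white_draws D n t = k].
Proof.
rewrite white_draws_bigcup; apply: fin_bigcup_measurable => // s _.
exact: measurable_history.
Qed.

Lemma measurable_walk1 n (z : int) : measurable [set t | walk1 D n t = z].
Proof.
rewrite (_ : [set _ | _] =
    \bigcup_(k in [set k | k%:Z - (n - k)%N%:Z = z]) [set t | white_draws D n t = k]).
  by apply: bigcup_measurable => k _; exact: measurable_white_draws.
apply/seteqP; split => t /=; rewrite /walk1 blue_drawsE.
  by move=> h; exists (white_draws D n t).
by move=> [k /= hk ->].
Qed.

Variables (w b : nat).
Hypotheses (w_gt0 : (0 < w)%N) (b_gt0 : (0 < b)%N).
Hypothesis urn : polya_urn w b D.

(** The Markov property of the urn: the composition of the urn depends on a
history only through its number of white draws, so the same proportion factors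
out of the sum over all histories with [k] white draws. *)
Lemma white_draws_step n k c :
  P ([set t | white_draws D n t = k] `&` [set t | D n t = c]) =
  (P [set t | white_draws D n t = k] *
    ((if c then w + k else b + (n - k))%N%:R / (w + b + n)%N%:R)%:E)%E.
Proof.
have tI (F : n.-tuple bool -> set T) : (forall s, F s `<=` history D s) ->
    trivIset [set s : n.-tuple bool | count_mem true s = k] F.
  move=> FD; apply/trivIsetP => s s' _ _; apply: contra_neqP => /eqP/set0P[t].
  by move=> [/FD hs /FD hs']; exact: history_inj hs hs'.
have fS : finite_set [set s : n.-tuple bool | count_mem true s = k] by [].
rewrite white_draws_bigcup setI_bigcupl (measure_fin_bigcup P fS); first last.
- by move=> s _; apply: measurableI; [exact: measurable_history|
    exact: measurable_draw].
- by apply: tI => s t [].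
rewrite (measure_fin_bigcup P fS); first last.
- by move=> s _; exact: measurable_history.
- by apply: tI => s t.
rewrite ge0_mule_fsuml; last by move=> s; exact: measure_ge0.
apply: eq_fsbigr => s /set_mem/= sk.
have -> : history D s `&` [set t | D n t = c] = history D (rcons s c).
  by rewrite history_rcons size_tuple.
rewrite urn; congr (_ * _%:E)%E.
have cF : count_mem false s = (n - k)%N.
  rewrite -sk -[X in (X - _)%N](size_tuple s) -(count_predC (pred1 true)) addKn.
  by apply: eq_count => -[].
have kn : (k <= n)%N by rewrite -sk -[X in (_ <= X)%N](size_tuple s) count_size.
congr (_ / _%:R); first by congr _%:R; case: c; rewrite /balls ?sk ?cF.
by rewrite /balls sk cF; lia.
Qed.

Lemma white_draws_gt n k : (n < k)%N -> P [set t | white_draws D n t = k] = 0%E.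
Proof.
move=> nk; rewrite (_ : [set _ | _] = set0) ?measure0//.
by apply/seteqP; split => t //= h; have := white_draws_le D n t; lia.
Qed.

(** The induction step bounds a point mass at time [n.+1] by a combination of
two point masses at time [n] whose weights add up to at most
[(n + c) / (n.+1 + c)], where [c = w + b - 1]; this turns the bound
[c / (n + c)] into [c / (n.+1 + c)]. *)
Lemma white_draws_bound n k :
  (P [set t | white_draws D n t = k] <=
    ((w + b).-1%:R / (n + (w + b).-1)%N%:R)%:E)%E.
Proof.
elim: n k => [|n IHn] k.
  rewrite add0n divff; first exact: probability_le1 (measurable_white_draws _ _).
  by rewrite pnatr_eq0; lia.
(* For k = 0 no white draw leads to k; the factor (0 < k) removes the second
   term there, since k.-1 = k. *)
have split_last : P [set t | white_draws D n.+1 t = k] =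
    (P ([set t | white_draws D n t = k] `&` [set t | D n t = false]) +
     P ([set t | white_draws D n t = k.-1] `&` [set t | D n t = true]) *
       (0 < k)%N%:R%:E)%E.
  have mI j c :
      measurable ([set t | white_draws D n t = j] `&` [set t | D n t = c]).
    by apply: measurableI; [exact: measurable_white_draws|exact: measurable_draw].
  case: k => [|k] /=.
    rewrite mule0 adde0; congr (P _); apply/seteqP; split => t /=;
    by rewrite white_drawsS; case: (D n t) => //=; rewrite ?addn0 ?addn1 => // -[].
  rewrite mule1 -measureU//.
    congr (P _); apply/seteqP; split => t /=; rewrite white_drawsS.
    - by case: (D n t) => /=; rewrite ?addn0 ?addn1; [case; right|left].
    - by case=> -[-> ->] /=; lia.
  by apply/seteqP; split => t //= [[_ ->] []].
rewrite split_last !white_draws_step.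
set c := (w + b).-1 in IHn *.
have fin j : P [set t | white_draws D n t = j] \is a fin_num.
  exact/fin_num_measure/measurable_white_draws.
have bound j : fine (P [set t | white_draws D n t = j]) <= c%:R / (n + c)%N%:R.
  by rewrite -lee_fin fineK.
have [nk|kn] := ltnP n.+1 k.
  rewrite !white_draws_gt ?mul0e ?adde0 ?lee_fin ?divr_ge0//; lia.
have mE : (w + b + n = n.+1 + c)%N by rewrite /c; lia.
have m_gt0 : 0 < (n + c)%N%:R :> R by rewrite ltr0n /c; lia.
have average (X Y : nat) : (X + Y <= n + c)%N ->
    fine (P [set t | white_draws D n t = k]) * X%:R +
    fine (P [set t | white_draws D n t = k.-1]) * Y%:R <= c%:R.
  move=> XY; apply: (@le_trans _ _ (c%:R / (n + c)%N%:R * (X + Y)%N%:R)).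
    by rewrite [(X + Y)%:R]natrD mulrDr lerD// ler_wpM2r.
  by rewrite mulrAC ler_pdivrMr// ler_wpM2l// ler_nat.
rewrite mE -(fineK (fin k)) -(fineK (fin k.-1)) -!EFinM -EFinD lee_fin.
rewrite !mulrA -[X in _ + X]mulrAC -mulrDl ler_wpM2r ?invr_ge0// -mulrA -natrM.
(* For k = n.+1 the weight b + (n - k) is b, because of truncated subtraction,
   and the sum of the weights is too large by one unit; but the point mass at
   k = n.+1 is zero at time n. *)
move: kn; rewrite leq_eqVlt => /predU1P[kE|kn]; last first.
  by apply: average; rewrite /c; lia.
subst k; have := average 0%N (w + n)%N.
rewrite white_draws_gt// !mul0r !add0r muln1; apply; rewrite /c; lia.
Qed.

End OneUrn.

(** * Summability and transience *)

Section Series.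
Variable R : realType.

(** Telescoping, from [1 / n ^ 2 <= 2 / n - 2 / (n + 1)] for [n >= 1]. *)
Lemma sum_inv_sqr_le (N : nat) :
  \sum_(0 <= n < N) (n.+1%:R ^-2 : R) <= 2 - 2 / N.+1%:R.
Proof.
elim: N => [|N IHN]; first by rewrite big_nil divr1 subrr.
rewrite big_nat_recr//=; apply: le_trans (lerD IHN (lexx _)) _.
have N1 : (1 : R) <= N.+1%:R by rewrite ler1n.
rewrite -[N.+2]addn1 natrD; move: (N.+1%:R : R) N1 => y y1.
rewrite -lerBrDl (_ : _ - _ = 2 / (y * (y + 1))); last by field; lra.
rewrite -[leLHS]div1r ler_pdivlMr ?mulr_gt0 1?mulrAC ?ler_pdivrMr; nra.
Qed.

Lemma nneseries_inv_sqr_lty (u : nat -> \bar R) (c : R) :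
  (forall n, 0 <= u n <= (c / n.+1%:R ^+ 2)%:E)%E ->
  (\sum_(0 <= n <oo) u n < +oo)%E.
Proof.
move=> hu.
have c_ge0 : 0 <= c.
  have /andP[h0 h1] := hu 0%N; have := le_trans h0 h1.
  by rewrite lee_fin expr1n divr1.
apply: (@le_lt_trans _ _ (c * 2)%:E); last exact: ltry.
apply: lime_le.
  by apply: is_cvg_nneseries => n _ _; have /andP[] := hu n.
apply: nearW => N.
apply: (@le_trans _ _ (\sum_(0 <= n < N) (c / n.+1%:R ^+ 2)%:E)%E).
  by apply: lee_sum => n _; have /andP[] := hu n.
rewrite sumEFin lee_fin -mulr_sumr ler_wpM2l//.
by apply: le_trans (sum_inv_sqr_le N) _; rewrite gerBl.
Qed.

End Series.

Theorem corollary3p1 (R : realType) (disp : measure_display)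
    (T : measurableType disp) (P : probability T R)
    (d : nat) (hd : (2 <= d)%N)
    (w b : 'I_d -> nat)
    (hw : forall i, (1 <= w i)%N) (hb : forall i, (1 <= b i)%N)
    (D : 'I_d -> nat -> {RV P >-> bool})
    (hurn : forall i, polya_urn (w i) (b i) (D i))
    (hindep : independent_processes P (fun i => walk1 (D i))) :
  transient_process P (walk D).
Proof.
move=> x _; rewrite /transient_state /recurrent_state.
suff -> : P (lim_sup_set (fun n => [set t | walk D n t = x])) = 0%E.
  by case => /eqP; rewrite eq_sym oner_eq0.
have walkE n : [set t | walk D n t = x] =
    \bigcap_(i in [set: 'I_d]) [set t | walk1 (D i) n t = x ord0 i].
  apply/seteqP; split => t /= h.
    by move=> i _ /=; rewrite -h mxE.
  by apply/rowP => i; rewrite mxE h.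
have mwalk n : measurable [set t | walk D n t = x].
  rewrite walkE; apply: fin_bigcap_measurable => // i _.
  exact: measurable_walk1.
pose i0 : 'I_d := Ordinal (ltnW hd); pose i1 : 'I_d := Ordinal hd.
have bound1 i n : (P [set t | walk1 (D i) n t = x ord0 i] <=
    ((w i + b i)%:R / n.+1%:R)%:E)%E.
  have [k hk] := walk1_fiber (D i) n (x ord0 i).
  apply: (@le_trans _ _ (P [set t | white_draws (D i) n t = k])).
    by apply: le_measure; rewrite ?inE//;
      [exact: measurable_walk1|exact: measurable_white_draws].
  apply: le_trans (white_draws_bound (hw i) (hb i) (hurn i) n k) _.
  have := hw i; have := hb i => bi wi.
  rewrite lee_fin ler_pM ?invr_ge0 ?ler_nat ?leq_pred//.
  by rewrite lef_pV2 ?posrE ?ltr0n ?ler_nat; lia.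
apply: lim_sup_set_cvg0 => //.
apply: (@nneseries_inv_sqr_lty _ _ ((w i0 + b i0)%:R * (w i1 + b i1)%:R)) => n.
rewrite measure_ge0/=.
(* Two coordinates give a summable bound already, so the others are dropped. *)
pose J := [set i0; i1]%SET.
apply: (@le_trans _ _ (P (\bigcap_(i in [set i | i \in J])
    [set t | walk1 (D i) n t = x ord0 i]))).
  apply: le_measure; rewrite ?inE//.
    by apply: fin_bigcap_measurable => // i _; exact: measurable_walk1.
  by rewrite walkE => t h i _; exact: h.
rewrite hindep; last first.
  move=> i _; apply: sub_sigma_algebra; exists n, [set x ord0 i].
  by apply/seteqP; split.
rewrite big_setU1 ?inE//= big_set1 expr2 invfM mulrACA EFinM.
by apply: lee_pmul; rewrite ?measure_ge0.
Qed.
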